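(* Let $G=(\rho_{n+m})_{n,m\in\mathbb N_0}$ be the moment matrix of the weight $$w(k)=\frac{(a_1)_k\cdots(a_M)_k}{k!\,(b_1)_k\cdots(b_N)_k}\,\eta^k,\qquad k\in\mathbb N_0 .$$ Then $G$ fulfills the hypergeometric relations $$(\Lambda+a_iI)\,G=a_i\;{}_iT\,G,\qquad i\in\{1,\dots,M\},$$ $$(\Lambda+(b_j-1)I)\,G=(b_j-1)\,T_j\,G,\qquad j\in\{1,\dots,N\},$$ $$\Lambda\,G=\eta\,\kappa\,B\,(T G)\,B^\top,\qquad \kappa:=\frac{\prod_{i=1}^Ma_i}{\prod_{j=1}^Nb_j}.$$
   Context: $\mathbb N_0=\{0,1,2,\dots\}$; matrices are semi-infinite, indexed by $\mathbb N_0$. $(\alpha)_k=\alpha(\alpha+1)\cdots(\alpha+k-1)$, $(\alpha)_0=1$, is the Pochhammer symbol. The weight is the solution (normalized by $w(0)=1$) of the Pearson equation $\theta(k+1)w(k+1)=\sigma(k)w(k)$ with $\theta(z)=z(z+b_1-1)\cdots(z+b_N-1)$ and $\sigma(z)=\eta(z+a_1)\cdots(z+a_M)$. The moments are $\rho_n=\sum_{k=0}^\infty k^nw(k)=\vartheta_\eta^n\,{}_MF_N(a_1,\dots,a_M;b_1,\dots,b_N;\eta)$ with $\vartheta_\eta=\eta\,\partial/\partial\eta$. It is assumed that all parameters, including the shifted ones below, are such that the weights are well defined and the moments converge. Shift operators acting on functions of the parameters, applied entrywise to $G$: ${}_iT$ replaces $a_i$ by $a_i+1$ and leaves all other parameters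 fixed; $T_j$ replaces $b_j$ by $b_j-1$ and leaves all other parameters fixed; $T={}_1T\cdots{}_MT\,T_1^{-1}\cdots T_N^{-1}$ replaces every $a_i$ by $a_i+1$ and every $b_j$ by $b_j+1$. $\Lambda$ is the shift matrix with ones on the first superdiagonal and zeros elsewhere, $I$ the identity, and $B$ the lower Pascal matrix, $B_{n,m}=\binom nm$ for $n\ge m$, $0$ otherwise. *)

(* Defs.v *)
From HB Require Import structures.
From mathcomp Require Import all_boot all_order all_algebra.
From mathcomp Require Import complex.
From mathcomp Require Import all_classical all_reals topology normedtype sequences.

Set Implicit Arguments.
Unset Strict Implicit.
Unset Printing Implicit Defensive.

Import Order.TTheory GRing.Theory Num.Theory.
Import numFieldNormedType.Exports.

Local Open Scope ring_scope.

(* Everything is defined over an arbitrary numFieldType, which covers both the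
   real and the complex numbers with their usual topology. *)

(* Sums, scalar multiples and equality of semi-infinite matrices are the
   pointwise ones of function types; [*%R] on this type is the entrywise
   product, not the matrix product. *)
Definition imx (K : numFieldType) := nat -> nat -> K.

Section InfiniteMatrices.
Variable K : numFieldType.

(* The entries are sums of series. When A is row-finite or B is column-finite,
   all but finitely many terms vanish and the series trivially converges. *)
Definition immul (A B : imx K) : imx K :=
  fun n m => limn (series (fun k => A n k * B k m)).

Definition imtr (A : imx K) : imx K := fun n m => A m n.

Definition imid : imx K := fun n m => (n == m)%:R.

Definition imshift : imx K := fun n m => (m == n.+1)%:R.

(* 'C(n, m) = 0 for m > n, so this is lower triangular. *)
Definition impascal : imx K := fun n m => 'C(n, m)%:R.

End InfiniteMatrices.

Arguments imid {K}.
Arguments imshift {K}.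
Arguments impascal {K}.

Notation "A *oo B" := (immul A B) (at level 40, left associativity) : ring_scope.

Section Hypergeometric.
Variable K : numFieldType.
Implicit Types (x eta : K) (n k : nat).

Definition pochhammer x k : K := \prod_(l < k) (x + l%:R).

Section Weight.
Variables M N : nat.
Implicit Types (a : 'I_M -> K) (b : 'I_N -> K).

Definition weight a b eta k : K :=
  (\prod_(i < M) pochhammer (a i) k)
    / (k`!%:R * \prod_(j < N) pochhammer (b j) k) * eta ^+ k.

(* 0 ^+ 0 = 1, so the zeroth moment contains the k = 0 term. *)
Definition moment_term a b eta n : nat -> K :=
  fun k => k%:R ^+ n * weight a b eta k.

Definition moment a b eta n : K := limn (series (moment_term a b eta n)).

Definition moment_matrix a b eta : imx K := fun n m => moment a b eta (n + m).

(* No denominator of the weight vanishes and all the moments converge.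
   The first clause matters because x / 0 = 0, the second because the limit of
   a divergent sequence is an unspecified value. *)
Definition admissible a b eta : Prop :=
  (forall j k, pochhammer (b j) k != 0) /\
  (forall n, cvgn (series (moment_term a b eta n))).

(* Operators on functions of all the parameters (a, b, eta), with values in any
   type X; on matrix-valued functions they act entrywise. *)
Section Shifts.
Variable X : Type.
Implicit Types F : ('I_M -> K) -> ('I_N -> K) -> K -> X.

Definition shift_a (i : 'I_M) F :=
  fun a b eta => F (fun l => if l == i then a l + 1 else a l) b eta.

(* T_j lowers b_j, so the operator [shift_all] raising all the b_j involves
   the inverses of the T_j. *)
Definition shift_b (j : 'I_N) F :=
  fun a b eta => F a (fun l => if l == j then b l - 1 else b l) eta.

Definition shift_all F :=
  fun a b eta => F (fun i => a i + 1) (fun j => b j + 1) eta.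

End Shifts.
End Weight.
End Hypergeometric.

(* Main.v *)
(** The moments are the values of the linear functional p |-> sum_k p(k) w(k),
    and multiplying G by Lambda on the left inserts a factor k. Each relation is
    thus a termwise identity between weights: x (x+1)_k = (x)_k (x+k), with
    x = a_i or x = b_j - 1, gives the first two. For the third, the k = 0 term
    of sum_k k^(n+m+1) w(k) vanishes, the Pearson equation
    (k+1) w(k+1) = eta kappa (T w)(k) applies after reindexing, and expanding
    (k+1)^n (k+1)^m by the binomial theorem produces the two Pascal factors. *)

Require Import Defs.
From HB Require Import structures.
From mathcomp Require Import all_boot all_order all_algebra.
From mathcomp Require Import complex.
From mathcomp Require Import ring.
From mathcomp Require Import all_classical all_reals topology normedtype sequences.

Set Implicit Arguments.
Unset Strict Implicit.
Unset Printing Implicit Defensive.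

Import Order.TTheory GRing.Theory Num.Theory.
Import numFieldNormedType.Exports.

Local Open Scope ring_scope.

Section MomentMatrices.
Local Open Scope classical_set_scope.
Local Open Scope ring_scope.

Lemma lim_cvgn (K : numFieldType) (u : nat -> K) (l : K) :
  u @ \oo --> l -> limn u = l.
Proof. by apply: cvg_lim; exact: norm_hausdorff. Qed.

(** The partial sums are constant from index [d] on. This turns the products with band and
    triangular matrices into finite sums. *)
Lemma lim_series_finite (K : numFieldType) (u : nat -> K) (d : nat) :
  (forall k, (d <= k)%N -> u k = 0) ->
  limn (series u) = \sum_(0 <= k < d) u k.
Proof.
move=> u0; apply: lim_cvgn; apply: cvg_near_cst.
exists d => //= n /= dn.
rewrite /series /= (big_cat_nat (n := d)) //= [X in _ + X]big_nat.
by rewrite [X in _ + X]big1 ?addr0 // => k /andP[/u0].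
Qed.

(** Serves to exchange the infinite sum over [k] with the two nested binomial sums of the third
    relation. *)
Lemma cvg_series_sum (K : numFieldType) (I : Type) (r : seq I) (c : I -> K)
    (u : I -> nat -> K) (l : I -> K) :
  (forall i, series (u i) @ \oo --> l i) ->
  series (fun k => \sum_(i <- r) c i * u i k) @ \oo
    --> \sum_(i <- r) c i * l i.
Proof.
move=> ul; elim: r => [|i r IH].
  rewrite big_nil; apply: cvg_near_cst; near=> n.
  by rewrite /series /= big1 // => k _; rewrite big_nil.
rewrite big_cons; under eq_fun do rewrite big_cons.
rewrite (_ : series _ = (fun n => c i * series (u i) n)
    + series (fun k => \sum_(j <- r) c j * u j k)).
  by apply: cvgD => //; apply: cvgMl_tmp.
by apply/funext => n; rewrite /series /= big_split -mulr_sumr.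
Unshelve. all: by end_near. Qed.

Lemma immul_shift (K : numFieldType) (A : imx K) (c : K) (n m : nat) :
  ((imshift + c *: imid) *oo A) n m = A n.+1 m + c * A n m.
Proof.
(* Row [n] of the left factor is supported on the columns [n] and [n.+1]. *)
rewrite /immul (@lim_series_finite _ _ n.+2) => [|k nk].
  rewrite !big_nat_recr //= big_nat big1 => [|k /andP[_ kn]];
    rewrite !fctE /imshift /imid /GRing.scale /=.
    by rewrite eqxx (ltn_eqF (ltnSn _)) eqxx
      mulr0 mulr1 addr0 !add0r mul1r addrC.
  by rewrite (ltn_eqF (ltnW kn : (k < n.+1)%N)) (gtn_eqF kn) mulr0 addr0 mul0r.
rewrite !fctE /imshift /imid /GRing.scale /=.
by rewrite (gtn_eqF nk) (ltn_eqF (ltnW nk)) mulr0 addr0 mul0r.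
Qed.

(** Both series terminate for every [A]: the outer one since the transposed Pascal matrix is upper
    triangular, the inner one since the Pascal matrix is lower triangular. *)
Lemma immul_pascal_congr (K : numFieldType) (A : imx K) (n m : nat) :
  (impascal *oo A *oo imtr impascal) n m =
    \sum_(0 <= q < m.+1) 'C(m, q)%:R
      * \sum_(0 <= p < n.+1) 'C(n, p)%:R * A p q.
Proof.
rewrite {1}/immul (@lim_series_finite _ _ m.+1) => [|k mk]; last first.
  by rewrite /imtr /impascal bin_small // mulr0.
apply: eq_bigr => q _; rewrite mulrC; congr (_ * _).
rewrite /immul (@lim_series_finite _ _ n.+1) // => k nk.
by rewrite /impascal bin_small // mul0r.
Qed.

Section Pochhammer.
Variable K : numFieldType.
Implicit Types (x : K) (k : nat).

Lemma pochhammerSr x k : pochhammer x k.+1 = pochhammer x k * (x + k%:R).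
Proof. by rewrite /pochhammer big_ord_recr. Qed.

Lemma pochhammerSl x k : pochhammer x k.+1 = x * pochhammer (x + 1) k.
Proof.
rewrite /pochhammer big_ord_recl addr0; congr (_ * _).
by apply: eq_bigr => i _; rewrite -addrA -mulrS.
Qed.

Lemma pochhammer_shift x k :
  x * pochhammer (x + 1) k = pochhammer x k * (x + k%:R).
Proof. by rewrite -pochhammerSl pochhammerSr. Qed.

End Pochhammer.

Section Weights.
Variables (K : numFieldType) (M N : nat).
Implicit Types (a : 'I_M -> K) (b : 'I_N -> K) (eta c : K) (n k : nat).

Lemma weight_shift_a a b eta i k :
  (k%:R + a i) * weight a b eta k
  = a i * shift_a i (fun a b eta => weight a b eta k) a b eta.
Proof.
rewrite /shift_a /weight !mulrA; congr (_ * _); congr (_ / _).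
rewrite (bigD1 i) //= [in RHS](bigD1 i) //= eqxx !mulrA pochhammer_shift.
rewrite [k%:R + _]addrC [_ * (_ + _)]mulrC; congr (_ * _).
by apply: eq_bigr => l /negPf ->.
Qed.

Lemma weight_shift_b a b eta j k :
  pochhammer (b j - 1) k.+1 != 0 ->
  (k%:R + (b j - 1)) * weight a b eta k
  = (b j - 1) * shift_b j (fun a b eta => weight a b eta k) a b eta.
Proof.
move=> b1; have e := pochhammer_shift (b j - 1) k; rewrite subrK in e.
(* Splitting off the last, then the first factor of [pochhammer (b j - 1) k.+1] shows that the
   [j]-th denominators on both sides are nonzero, as the final cross-multiplication requires. *)
have := b1; rewrite pochhammerSr mulf_eq0 negb_or => /andP[b1k _].
move: b1; rewrite pochhammerSl subrK mulf_eq0 negb_or => /andP[_ bk].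
rewrite /shift_b /weight (bigD1 j) //= [in RHS](bigD1 j) //= eqxx.
have -> : \prod_(l < N | l != j) pochhammer (if l == j then b l - 1 else b l) k
    = \prod_(l < N | l != j) pochhammer (b l) k.
  by apply: eq_bigr => l /negPf ->.
rewrite ![in LHS]mulrA ![in RHS]mulrA; congr (_ * _).
rewrite !invfM ![in LHS]mulrA ![in RHS]mulrA; congr (_ / _).
rewrite [in LHS]mulrAC [in RHS]mulrAC; congr (_ / _).
rewrite ![_ * (\prod_(i < M) _)]mulrC -!mulrA; congr (_ * _).
by apply/eqP; rewrite eqr_div // e addrC mulrC.
Qed.

(** This is the Pearson equation: each Pochhammer symbol releases its first factor into the
    constant, and [k.+1] cancels against the factorial. *)
Lemma weight_shift_all a b eta k :
  k.+1%:R * weight a b eta k.+1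
  = eta * ((\prod_(i < M) a i) / (\prod_(j < N) b j))
      * shift_all (fun a b eta => weight a b eta k) a b eta.
Proof.
rewrite /shift_all /weight factS natrM exprS.
under eq_bigr do rewrite pochhammerSl.
rewrite big_split /=.
under [X in _ / (_ * X)]eq_bigr do rewrite pochhammerSl.
rewrite big_split /= !invfM.
have k0 : k.+1%:R != 0 :> K by rewrite pnatr_eq0.
set A := \prod_(i < M) a i; set B := (\prod_(j < N) b j)^-1.
set P := \prod_(i < M) _; set Q := (\prod_(j < N) _)^-1.
set f := (k`!%:R)^-1.
(* With the other inverses kept as atoms, the only cancellation outside [ring] is that of [k.+1]. *)
transitivity ((k.+1%:R / k.+1%:R) * (A * P * (f * (B * Q)) * (eta * eta ^+ k))).
  by ring.
by rewrite divff // mul1r; ring.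
Qed.

Lemma cvg_moment a b eta n : admissible a b eta ->
  series (moment_term a b eta n) @ \oo --> moment a b eta n.
Proof. by case=> _; apply. Qed.

(** Multiplying the weight identity by [k ^ n] and summing gives the claim, the factor [k] raising
    the order of the moment; convergence of all series involved allows the limits to be taken
    separately. *)
Lemma moment_scaled_weight a b a' b' eta c n :
  admissible a b eta -> admissible a' b' eta ->
  (forall k, (k%:R + c) * weight a b eta k = c * weight a' b' eta k) ->
  moment a b eta n.+1 + c * moment a b eta n = c * moment a' b' eta n.
Proof.
move=> adm adm' e.
have cl : series (moment_term a b eta n.+1)
            + (fun d => c * series (moment_term a b eta n) d) @ \oo
          --> moment a b eta n.+1 + c * moment a b eta n.
  by apply: cvgD; [|apply: cvgMl_tmp]; apply: cvg_moment.
have cr : (fun d => c * series (moment_term a' b' eta n) d) @ \oo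
          --> c * moment a' b' eta n.
  by apply: cvgMl_tmp; apply: cvg_moment.
rewrite -(lim_cvgn cl) -(lim_cvgn cr); congr (limn _).
apply/funext => d; rewrite fctE /series /= !mulr_sumr -big_split /=.
apply: eq_bigr => k _.
by rewrite /moment_term exprSr [RHS]mulrCA -e; ring.
Qed.

Lemma moment_shift_all a b eta n m :
  shift_all (@admissible K M N) a b eta ->
  moment a b eta (n + m).+1 =
    eta * ((\prod_(i < M) a i) / (\prod_(j < N) b j))
      * \sum_(0 <= q < m.+1) 'C(m, q)%:R
          * \sum_(0 <= p < n.+1) 'C(n, p)%:R
              * shift_all (@moment K M N) a b eta (p + q).
Proof.
move=> adm.
set c := eta * _; set S := \sum_(0 <= q < m.+1) _.
(* Partial sums with one more term have the same limit; their [k = 0] term vanishes because the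
   exponent is positive, which reindexes the series. *)
apply: lim_cvgn; rewrite -cvg_shiftS.
pose u k := \sum_(0 <= q < m.+1) 'C(m, q)%:R
  * \sum_(0 <= p < n.+1) 'C(n, p)%:R
      * shift_all (@moment_term K M N) a b eta (p + q) k.
suff -> : [sequence series (moment_term a b eta (n + m).+1) d.+1]_d
    = (fun d => c * series u d).
  apply: cvgMl_tmp; apply: cvg_series_sum => q; apply: cvg_series_sum => p.
  exact: cvg_moment.
apply/funext => d; rewrite /series /= mulr_sumr big_nat_recl //=.
rewrite {1}/moment_term exprS !mul0r add0r; apply: eq_bigr => k _.
rewrite /moment_term exprSr -mulrA weight_shift_all -/c mulrCA; congr (_ * _).
(* Writing [k.+1] as [1 + k], in this order, makes the summation index of the binomial theorem the
   exponent of [k]. *)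
rewrite exprD [k.+1%:R]mulrS ![(1 + _) ^+ _]exprDn /u big_mkord.
under [in RHS]eq_bigr do rewrite big_mkord.
rewrite [X in X * _]mulrC -mulrA mulr_suml; apply: eq_bigr => q _.
rewrite expr1n mul1r -mulr_natl -mulrA; congr (_ * _).
rewrite mulrC !mulr_suml; apply: eq_bigr => p _.
by rewrite expr1n mul1r -mulr_natl /shift_all /moment_term exprD; ring.
Qed.

End Weights.

End MomentMatrices.

Theorem theorem4 (R : realType) (M N : nat)
    (a : 'I_M -> R[i]) (b : 'I_N -> R[i]) (eta : R[i])
    (adm : admissible a b eta)
    (adm_a : forall i : 'I_M, shift_a i (@admissible _ M N) a b eta)
    (adm_b : forall j : 'I_N, shift_b j (@admissible _ M N) a b eta)
    (adm_all : shift_all (@admissible _ M N) a b eta) :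
  let G := @moment_matrix _ M N in
  let kappa := (\prod_(i < M) a i) / (\prod_(j < N) b j) in
  [/\ forall i : 'I_M,
        (imshift + a i *: imid) *oo G a b eta = a i *: shift_a i G a b eta,
      forall j : 'I_N,
        (imshift + (b j - 1) *: imid) *oo G a b eta
          = (b j - 1) *: shift_b j G a b eta
    & imshift *oo G a b eta
        = (eta * kappa) *: (impascal *oo shift_all G a b eta *oo imtr impascal)].
Proof.
move=> G kappa; split=> [i|j|].
- apply/funext => n; apply/funext => m; rewrite immul_shift.
  exact: (moment_scaled_weight (n + m) adm (adm_a i)
    (weight_shift_a a b eta i)).
(* Admissibility of the parameters with [b j] lowered gives this nonvanishing. *)
- have b1 k : pochhammer (b j - 1) k != 0.
    by have [/(_ j k)] := adm_b j; rewrite eqxx.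
  apply/funext => n; apply/funext => m; rewrite immul_shift.
  exact: (moment_scaled_weight (n + m) adm (adm_b j)
    (fun k => weight_shift_b a eta (b1 k.+1))).
- apply/funext => n; apply/funext => m.
  (* The pure shift is the case [c = 0]. *)
  have := immul_shift (G a b eta) 0 n m.
  rewrite scale0r addr0 mul0r addr0 => ->.
  rewrite [RHS](_ : _ = eta * kappa
    * (impascal *oo shift_all G a b eta *oo imtr impascal) n m) //.
  rewrite immul_pascal_congr.
  exact: (moment_shift_all n m adm_all).
Qed.
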